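(* Let $t$ be a positive integer and let $G$ be a connected graph. If every vertex $u$ of $G$ has $\chi(N_1(u))\ge t-1$, then $$\chi_c(G)\ge \frac{t\,|V(G)|}{\alpha_t(G)}.$$
   Context: Graphs are finite, simple and undirected. For positive integers $k\ge 2d$, a $(k,d)$-coloring of $G$ is a map $f:V(G)\to\{0,1,\dots,k-1\}$ such that $d\le |f(x)-f(y)|\le k-d$ for every edge $xy$; $G$ is $(k,d)$-colorable if it has one. The circular chromatic number is $\chi_c(G)=\inf\{k/d: G\text{ is }(k,d)\text{-colorable}\}$. $N_1(u)$ is the set of vertices adjacent to $u$; $\chi(S)$ for $S\subseteq V(G)$ denotes the (ordinary) chromatic number of the subgraph of $G$ induced by $S$. $\alpha_t(G)$ is the maximum number of vertices in a vertex-induced $t$-colorable subgraph of $G$. *)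

(* Defs.v *)
From mathcomp Require Import all_boot all_order all_algebra.
From mathcomp Require Import boolp classical_sets reals.

Set Implicit Arguments.
Unset Strict Implicit.
Unset Printing Implicit Defensive.

Import Order.TTheory GRing.Theory Num.Theory.

Record sgraph := SGraph {
  vertex :> finType;
  adj : rel vertex;
  adj_sym : symmetric adj;
  adj_irr : irreflexive adj }.

Section Graphs.
Variable G : sgraph.
Implicit Types (S : {set G}) (u x y : G) (n k d t : nat).

(* The null graph is not considered connected. *)
Definition connected : Prop :=
  0 < #|{: G}| /\ forall x y, connect (@adj G) x y.

Definition neighbours u : {set G} := [set x | adj u x].

Definition induced_adj S : rel {x : G | x \in S} :=
  fun v w => adj (val v) (val w).

Lemma induced_sym S : symmetric (@induced_adj S).
Proof. by move=> x y; exact: adj_sym. Qed.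

Lemma induced_irr S : irreflexive (@induced_adj S).
Proof. by move=> x; exact: adj_irr. Qed.

Definition induced S : sgraph := SGraph (@induced_sym S) (@induced_irr S).

Definition colorable n : bool :=
  [exists f : {ffun G -> 'I_n}, [forall x, forall y, adj x y ==> (f x != f y)]].

Lemma ex_colorable : exists n, colorable n.
Proof.
exists #|{: G}|; apply/existsP; exists [ffun x => enum_rank x].
apply/forallP => x; apply/forallP => y; apply/implyP => xy; rewrite !ffunE.
by apply: contraTneq xy => /enum_rank_inj ->; rewrite adj_irr.
Qed.

(* The chromatic number; it is 0 exactly for the null graph. *)
Definition chromatic_number : nat := ex_minn ex_colorable.

(* The distance `|m - n|%N is taken in int, hence not truncated. *)
Definition kd_colorable k d : Prop :=
  exists f : G -> 'I_k,
    forall x y, adj x y -> d <= `|(f x : nat) - (f y : nat)|%N <= k - d.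

End Graphs.

Definition alpha (t : nat) (G : sgraph) : nat :=
  \max_(S : {set G} | colorable (induced S) t) #|S|.

Definition circular_ratios (R : realType) (G : sgraph) : set R :=
  [set q : R | exists k d : nat,
     [/\ 0 < d, 2 * d <= k, kd_colorable G k d & q = (k%:R / d%:R)%R]]%classic.
Arguments circular_ratios : clear implicits.

Definition circular_chromatic_number (R : realType) (G : sgraph) : R :=
  inf (circular_ratios R G).

(* [inf] is a genuine infimum here, not the default value 0. *)
Lemma has_inf_circular_ratios (R : realType) (G : sgraph) :
  has_inf (circular_ratios R G).
Proof.
split; last first.
  by exists 0%R => q [k [d [_ _ _ ->]]]; rewrite divr_ge0 ?ler0n.
exists (#|{: G}|.+2%:R / 1%:R)%R; exists #|{: G}|.+2, 1; split => //.
exists (fun x => widen_ord (leqW (leqnSn _)) (enum_rank x)) => x y xy /=.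
have ne : (enum_rank x : nat) <> enum_rank y.
  by move=> /val_inj /enum_rank_inj xy'; rewrite xy' adj_irr in xy.
have := ltn_ord (enum_rank x); have := ltn_ord (enum_rank y).
move: (enum_rank x : nat) (enum_rank y : nat) ne => a b ne bG aG.
wlog ab : a b ne aG bG / a <= b.
  by move=> H; case/orP: (leq_total a b) => h; [|rewrite distnC]; apply: H => // /esym.
rewrite distnEr // subn1 /= subn_gt0 ltn_neqAle ab andbT; apply/andP; split.
  exact/eqP.
by apply: leq_trans (leq_subr _ _) _; exact/ltnW/ltnW.
Qed.

(* Main.v *)
Require Import Defs.
From mathcomp Require Import all_boot all_order all_algebra.
From mathcomp Require Import boolp classical_sets reals.
From mathcomp Require Import zify.

Set Implicit Arguments.
Unset Strict Implicit.
Unset Printing Implicit Defensive.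

(** Place the [k] colours of a (k,d)-coloring on a circle: adjacent vertices
    have colours at circular distance at least [d], so any [d] consecutive
    colours span an independent set, and any [n * d] consecutive colours span
    an [n]-colorable subgraph ([arc_colorable]).

    This is used twice.  First, the neighbours of a vertex [u] avoid the
    [2 * d - 1] colours nearest to that of [u], so their colours lie on an arc
    of [k - 2 * d + 1] colours.  If [k < t * d], then [2 < t] because
    [2 * d <= k], and this arc has at most [(t - 2) * d] colours; so the
    neighbourhood is [(t - 2)]-colorable, against the hypothesis.  Hence
    [t * d <= k] ([neighbourhood_bound]).  Secondly, [t * d] consecutive
    colours then form an arc that does not overlap itself, and the vertices
    coloured from it number at most [alpha t G].  Each vertex is caught by
    exactly [t * d] of the [k] rotations of this arc, so double counting gives
    [t * d * #|G| <= k * alpha t G] ([window_count]).  Dividing yields the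
    bound for every ratio [k / d], hence for their infimum. *)

Import Order.TTheory GRing.Theory Num.Theory.

(** The residue of [c - i] modulo [k] when [i, c < k], written without [%%] so
    that it stays within linear arithmetic. *)
Definition offset (k i c : nat) : nat := if i <= c then c - i else c + k - i.

(** Seen from any origin [i] the distance of two colours is either unchanged or
    replaced by its complement to [k], and the constraint on adjacent colours
    is symmetric under this exchange. *)
Lemma offset_dist (k d i a b : nat) : i < k -> a < k -> b < k ->
  d <= `|a - b| <= k - d ->
  d <= `|offset k i a - offset k i b|.
Proof. by rewrite /offset; do 2 case: ifP; lia. Qed.

(** The offset is involutive in the origin, so the origins that see a colour
    [c] within the first [m] places are as many as those places. *)
Lemma card_offset_lt (k m : nat) (c : 'I_k) : m <= k ->
  #|[set i : 'I_k | offset k i c < m]| = m.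
Proof.
move=> mk.
have ltk (i : 'I_k) : offset k i c < k.
  by rewrite /offset; have := ltn_ord i; have := ltn_ord c; case: ifP; lia.
pose h (i : 'I_k) := Ordinal (ltk i).
have hK : involutive h.
  move=> i; apply: val_inj; rewrite /= /offset.
  by have := ltn_ord i; have := ltn_ord c; do 2 case: ifP; lia.
have -> : [set i : 'I_k | offset k i c < m]
          = h @: [set widen_ord mk j | j : 'I_m].
  apply/setP => i; rewrite inE; apply/idP/imsetP.
    move=> im; exists (h i); last by rewrite hK.
    by apply/imsetP; exists (Ordinal im) => //; apply: val_inj.
  case=> j /imsetP[j' _ ->] ->.
  have /(congr1 val) /= := hK (widen_ord mk j'); rewrite /h /= => ->.
  exact: ltn_ord.
rewrite card_imset; last exact: inv_inj.
rewrite card_imset ?cardsT ?card_ord // => a b /(congr1 val) /= ab.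
exact: val_inj.
Qed.

Lemma colorable_chromatic (H : sgraph) (n : nat) :
  colorable H n -> chromatic_number H <= n.
Proof. by rewrite /chromatic_number; case: ex_minnP => m _; apply. Qed.

Section Coloring.
Variables (G : sgraph) (k d : nat) (f : G -> 'I_k).
Hypothesis d_gt0 : 0 < d.
Hypothesis f_kd :
  forall x y, adj x y -> d <= `|(f x : nat) - (f y : nat)| <= k - d.

(** Cut the arc of [n * d] colours starting [a] places after [i] into [n]
    blocks of [d]: each block is an independent set, so the block number is a
    proper coloring. *)
Lemma arc_colorable (S : {set G}) (i a n : nat) : i < k ->
  (forall x, x \in S -> a <= offset k i (f x) < a + n * d) ->
  colorable (induced S) n.
Proof.
move=> ik Sarc.
have block_lt (x : induced S) : (offset k i (f (val x)) - a) %/ d < n.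
  by rewrite ltn_divLR //; have := Sarc _ (valP x); lia.
apply/existsP; exists [ffun x => Ordinal (block_lt x)].
apply/forallP => x; apply/forallP => y; apply/implyP => xy; rewrite !ffunE.
apply/eqP => /(congr1 val) /= same.
have /= := offset_dist ik (ltn_ord _) (ltn_ord _) (f_kd xy).
have := Sarc _ (valP x); have := Sarc _ (valP y); rewrite /= in same *.
move: (offset _ _ _) (offset _ _ _) same => p q same.
have := divn_eq (p - a) d; have := divn_eq (q - a) d; rewrite same.
by have := ltn_pmod (p - a) d_gt0; have := ltn_pmod (q - a) d_gt0; lia.
Qed.

(** A vertex together with its neighbourhood already forces [t * d] colours:
    as seen from [u], its neighbours have offsets from [d] to [k - d]. *)
Lemma neighbourhood_bound (u : G) (t : nat) : 0 < t -> 2 * d <= k ->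
  t - 1 <= chromatic_number (induced (neighbours u)) -> t * d <= k.
Proof.
move=> t_gt0 dk chi_u; rewrite leqNgt; apply/negP => k_lt.
have t_gt2 : 2 < t by rewrite ltnNge; apply/negP => t_le2; nia.
suff /colorable_chromatic : colorable (induced (neighbours u)) (t - 2) by lia.
apply: (@arc_colorable _ (f u) d) => // x; rewrite inE => /f_kd.
have := ltn_ord (f u); have := ltn_ord (f x); rewrite /offset.
by rewrite mulnBl; case: ifP; lia.
Qed.

(** Double counting of the pairs of a vertex and an arc of [t * d] colours
    containing its colour. *)
Lemma window_count (t : nat) : t * d <= k ->
  t * d * #|{: G}| <= k * alpha t G.
Proof.
move=> tdk; pose W (i : 'I_k) := [set x | offset k i (f x) < t * d].
have W_le i : #|W i| <= alpha t G.
  apply: (leq_bigmax_cond (F := fun S : {set G} => #|S|)).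
  by apply: (@arc_colorable _ i 0) => // x; rewrite inE.
have <- : \sum_(i < k) #|W i| = t * d * #|{: G}|.
  transitivity (\sum_(i < k) \sum_(x : G) (offset k i (f x) < t * d : nat)).
    by apply: eq_bigr => i _; rewrite -sum1dep_card big_mkcond.
  rewrite exchange_big [RHS]mulnC -sum_nat_const; apply: eq_bigr => x _.
  by rewrite -[RHS](card_offset_lt (f x) tdk) -sum1dep_card [RHS]big_mkcond.
by rewrite -[k in leqRHS]card_ord -sum_nat_const leq_sum.
Qed.

End Coloring.

Local Open Scope ring_scope.

Theorem theorem9 (R : realType) (t : nat) (G : sgraph) :
  (0 < t)%N ->
  connected G ->
  (forall u : G, (t - 1 <= chromatic_number (induced (neighbours u)))%N) ->
  circular_chromatic_number R G >= t%:R * #|{: G}|%:R / (alpha t G)%:R.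
Proof.
move=> t_gt0 [/card_gt0P[u _] _] chiN.
apply: lb_le_inf; first by case: (has_inf_circular_ratios R G).
move=> _ [k [d [d_gt0 dk [f f_kd] ->]]].
have tdk := neighbourhood_bound d_gt0 f_kd t_gt0 dk (chiN u).
have := window_count d_gt0 f_kd tdk.
(* A zero [alpha t G] would make the left-hand side [0] by convention. *)
have [->|a_gt0] := posnP (alpha t G).
  by rewrite invr0 mulr0 divr_ge0 ?ler0n.
rewrite ler_pdivrMr ?ltr0n // mulrAC ler_pdivlMr ?ltr0n //.
by rewrite -!natrM ler_nat mulnAC.
Qed.
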